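(* Let $X$ be a Banach space and $T:X\rightrightarrows X^*$ a maximal monotone multifunction. For $\varepsilon\ge 0$ and $x\in X$ let $$T^\varepsilon(x)=\{x^*\in X^*: \langle x^*-y^*,x-y\rangle\ge-\varepsilon\|x-y\|\ \text{ for all }(y,y^* )\in G(T)\}.$$ Then $T$ is regular if and only if $D_{T^\varepsilon}=D_T$ for every $\varepsilon>0$.
   Context: $X$ is a (real) Banach space with topological dual $X^*$ and $\langle x^*,x\rangle=\langle x,x^*\rangle$ denotes the evaluation pairing. For a multifunction $T:X\rightrightarrows X^*$, its graph is $G(T)=\{(x,x^* )\in X\times X^*: x^*\in T(x)\}$ and its domain is $D_T=\{x\in X: T(x)\neq\emptyset\}$; likewise $D_{T^\varepsilon}=\{x\in X: T^\varepsilon(x)\neq\emptyset\}$. $T$ is monotone if $\langle x^*-y^*,x-y\rangle\ge 0$ for all $(x,x^* ),(y,y^* )\in G(T)$; it is maximal monotone if it is monotone and there is no monotone multifunction $S:X\rightrightarrows X^*$ whose graph strictly contains $G(T)$. For $(x,x^* )\in X\times X^*$ put $$L(x,x^*,T)=\max\left\{0,\ \sup\left\{\frac{\langle x^*-y^*,y-x\rangle}{\|x-y\|}: (y,y^* )\in G(T),\ y\neq x\right\}\right\}\in[0,\infty],$$ and $d(x^*,T(x))=\inf\{\|y^*-x^*\|: y^*\in T(x)\}$, with $d(x^*,\emptyset)=\infty$. A maximal monotone multifunction $T$ is called regular if $L(x,x^*,T)=d(x^*,T(x))$ for every $(x,x^* )\in X\times X^*$. *)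

(* Defs.v *)
From HB Require Import structures.
From mathcomp Require Import all_boot all_order all_algebra.
From mathcomp Require Import all_classical all_reals all_analysis.

Set Implicit Arguments.
Unset Strict Implicit.
Unset Printing Implicit Defensive.

Import Order.TTheory GRing.Theory Num.Theory.
Import numFieldNormedType.Exports.

Local Open Scope classical_set_scope.
Local Open Scope ring_scope.

Section TopologicalDual.
Context {R : realType} {X : normedModType R}.

Definition dual_pred : {pred X -> R^o} :=
  mem [set f : X -> R^o | linear f /\ continuous f].

Lemma dual_submod_closed : submod_closed dual_pred.
Proof.
split => [|a f g].
  rewrite inE; split; last by move=> x; exact: cst_continuous.
  by move=> a x y; rewrite /= scaler0 addr0.
rewrite !inE => -[lf cf] [lg cg]; split.
  move=> b x y /=; rewrite /GRing.add /GRing.scale /= lf lg /GRing.scale /=.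
  by rewrite !mulrDr !mulrA (mulrC a b) addrACA.
move=> x; apply: (@continuousD _ _ _ (a *: f) g); last exact: cg.
exact: (@continuousZl_tmp _ _ _ f a _ (cf x)).
Qed.

HB.instance Definition _ :=
  GRing.isSubmodClosed.Build _ _ dual_pred dual_submod_closed.

End TopologicalDual.

Record dual (R : realType) (X : normedModType R) := Dual {
  dual_fun :> X -> R^o;
  dual_funP : dual_fun \in dual_pred
}.

Section DualNorm.
Context {R : realType} {X : normedModType R}.
Implicit Types f g : dual X.

HB.instance Definition _ := [isSub for @dual_fun R X].
HB.instance Definition _ := [Choice of dual X by <:].
HB.instance Definition _ := [SubChoice_isSubLmodule of dual X by <:].

Lemma dual_linear f : linear f.
Proof. by have := dual_funP f; rewrite inE => -[]. Qed.

Lemma dual_continuous f : continuous f.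
Proof. by have := dual_funP f; rewrite inE => -[]. Qed.

HB.instance Definition _ f :=
  GRing.isLinear.Build R X R^o *:%R (dual_fun f) (dual_linear f).

Lemma dualDE f g x : (f + g) x = f x + g x. Proof. by []. Qed.
Lemma dualNE f x : (- f) x = - f x. Proof. by []. Qed.
Lemma dualZE (a : R) f x : (a *: f) x = a * f x. Proof. by []. Qed.

Definition dual_ball f : set R :=
  [set `|f x| | x in [set x : X | `|x| <= 1]].

(* dual_norm_has_sup rules out the default value 0 that sup takes on unbounded
   sets. *)
Definition dual_norm f : R := sup (dual_ball f).

Lemma dual_norm_has_sup f : has_sup (dual_ball f).
Proof.
split; first by exists `|f 0|, 0 => //=; rewrite normr0.
have /linear_bounded_continuous/bounded_funP/(_ 1)[M fM] :=
  @dual_continuous f.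
by exists M => _ [x x1 <-]; exact: fM.
Qed.

Lemma dual_norm_ub f x : `|x| <= 1 -> `|f x| <= dual_norm f.
Proof.
by move=> x1; apply: sup_upper_bound; [exact: dual_norm_has_sup|exists x].
Qed.

Lemma dual_norm_le f (M : R) :
  (forall x, `|x| <= 1 -> `|f x| <= M) -> dual_norm f <= M.
Proof.
move=> fM; apply: ge_sup; first by case: (dual_norm_has_sup f).
by move=> _ [x x1 <-]; exact: fM.
Qed.

Lemma dual_norm_ge0 f : 0 <= dual_norm f.
Proof. by apply: le_trans (@dual_norm_ub f 0 _); rewrite // normr0. Qed.

Lemma dual_normD f g : dual_norm (f + g) <= dual_norm f + dual_norm g.
Proof.
apply: dual_norm_le => x x1; rewrite dualDE.
by rewrite (le_trans (ler_normD _ _))// lerD// dual_norm_ub.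
Qed.

Lemma dual_normZ (a : R) f : dual_norm (a *: f) = `|a| * dual_norm f.
Proof.
have le b g : dual_norm (b *: g) <= `|b| * dual_norm g.
  by apply: dual_norm_le => x x1; rewrite dualZE normrM ler_wpM2l// dual_norm_ub.
apply/eqP; rewrite eq_le le/=.
have [->|a0] := eqVneq a 0; first by rewrite normr0 mul0r dual_norm_ge0.
have := le a^-1 (a *: f).
by rewrite scalerA mulVf// scale1r normfV ler_pdivlMl// normr_gt0.
Qed.

Lemma dual_norm_eq0 f : dual_norm f = 0 -> f = 0.
Proof.
move=> f0; apply/val_inj/funext => x /=.
have [->|x0] := eqVneq x 0; first by rewrite (linear0 (dual_fun f)).
have := @dual_norm_ub f (`|x|^-1 *: x).
rewrite normrZ normfV normr_id mulVf ?normr_eq0// => /(_ (lexx _)).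
rewrite f0 normr_le0 linearZ/= mulf_eq0 invr_eq0 normr_eq0 (negPf x0)/=.
by move/eqP.
Qed.

HB.instance Definition _ := Lmodule_isNormed.Build R (dual X)
  dual_normD dual_normZ dual_norm_eq0.

Lemma dual_normE f : `|f| = sup (dual_ball f). Proof. by []. Qed.

End DualNorm.

Section Multifunctions.
Context {R : realType} {X : normedModType R}.
Implicit Types (T S : X -> set (dual X)) (x y : X) (xs ys : dual X).

Definition graph T : set (X * dual X) := [set p | T p.1 p.2].

Definition domain T : set X := [set x | T x !=set0].

Definition monotone T : Prop :=
  forall x xs y ys, graph T (x, xs) -> graph T (y, ys) ->
    0 <= (xs - ys) (x - y).

Definition maximal_monotone T : Prop :=
  monotone T /\ ~ (exists S, monotone S /\ graph T `<` graph S).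

Definition gap x xs T : \bar R :=
  maxe 0%E (ereal_sup [set ((xs - p.2) (p.1 - x) / `|x - p.1|)%:E |
                       p in [set p | graph T p /\ p.1 <> x]]).

(* dist xs set0 = +oo, since ereal_inf set0 = +oo. *)
Definition dist xs (A : set (dual X)) : \bar R :=
  ereal_inf [set `|ys - xs|%:E | ys in A].

Definition regular T : Prop :=
  maximal_monotone T /\ forall x xs, gap x xs T = dist xs (T x).

Definition enlargement (eps : R) T : X -> set (dual X) := fun x =>
  [set xs | forall y ys, graph T (y, ys) ->
    - eps * `|x - y| <= (xs - ys) (x - y)].

End Multifunctions.

(* Main.v *)
(** The inequality [gap x xs T <= dist xs (T x)] always holds, and
    [gap x xs T <= l] means that [xs] belongs to [enlargement l T x], so
    regularity forces the domains to agree.  Conversely, let [xs] be in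
    [enlargement l T x].  By maximality [xs + w] is in [T x] as soon as
    [w (y - x) <= (ys - xs) (y - x)] on the graph, and the Mazur-Orlicz theorem
    yields such a [w] of norm at most [l] provided that every consequence
    [w v <= c] of these constraints satisfies [- c <= l * `|v|].  If one does not,
    the points [x + s v] with small [s > 0] lie in the domain of an enlargement
    of [T] but not in the domain of [T]. *)

Require Import Defs.
From HB Require Import structures.
From mathcomp Require Import all_boot all_order all_algebra.
From mathcomp Require Import all_classical all_reals all_analysis.
From mathcomp Require Import ring lra.
Import Order.TTheory GRing.Theory Num.Theory.
Import numFieldNormedType.Exports.
Local Open Scope classical_set_scope.
Local Open Scope ring_scope.

(** * Sublinear functionals and the Mazur-Orlicz theorem *)

Lemma le_infD (R : realType) (A B : set R) (z : R) :
  A !=set0 -> B !=set0 -> (forall a b, A a -> B b -> z <= a + b) ->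
  z <= inf A + inf B.
Proof.
move=> A0 B0 zAB; rewrite -lerBlDr; apply: lb_le_inf => // a Aa.
by rewrite lerBlDr -lerBlDl; apply: lb_le_inf => // b Bb; rewrite lerBlDl zAB.
Qed.

Section Sublinear.
Context {R : realType} {X : lmodType R}.
Implicit Types (p q m : X -> R) (K : X -> R -> Prop).

(** An inequality suffices for homogeneity: applying it to [t^-1] as well gives equality. *)
Definition sublinear q : Prop :=
  (forall x y, q (x + y) <= q x + q y) /\
  (forall t x, 0 < t -> q (t *: x) <= t * q x).

(** [K v c] stands for the constraint [f v <= c] on an unknown functional [f]. *)
Definition convex_cone K : Prop :=
  [/\ K 0 0,
      forall u a v b, K u a -> K v b -> K (u + v) (a + b) &
      forall t v c, 0 < t -> K v c -> K (t *: v) (t * c)].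

Lemma sublinear0 q : sublinear q -> q 0 = 0.
Proof.
move=> [qD qZ]; have := qD 0 0; have := qZ 2^-1 0; rewrite scaler0 addr0.
lra.
Qed.

Lemma sublinearN q x : sublinear q -> - q (- x) <= q x.
Proof. by move=> hq; have := hq.1 x (- x); rewrite subrr sublinear0//; lra. Qed.

Lemma sublinearZ q t x : sublinear q -> 0 < t -> q (t *: x) = t * q x.
Proof.
move=> [_ qZ] t0; apply/eqP; rewrite eq_le qZ//=.
have := qZ t^-1 (t *: x); rewrite invr_gt0 => /(_ t0).
by rewrite scalerA mulVf ?gt_eqF// scale1r ler_pdivlMl.
Qed.

(** Take for [r x] the infimum of [q (x - v) + c] over [K v c]. The hypothesis on [K] bounds it
    below by [- q (- x)]. *)
Lemma sublinear_reduction q K : sublinear q -> convex_cone K ->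
  (forall v c, K v c -> 0 <= q (- v) + c) ->
  exists r, [/\ sublinear r, forall x, r x <= q x & forall v c, K v c -> r v <= c].
Proof.
move=> hq [K0 KD KZ] Kq.
pose A x : set R := [set z | exists v c, K v c /\ z = q (x - v) + c].
have A0 x : A x !=set0 by exists (q (x - 0) + 0), 0, 0.
have Alb x : has_lbound (A x).
  exists (- q (- x)) => _ [v [c [Kvc ->]]].
  have := Kq _ _ Kvc; have := hq.1 (- x) (x - v).
  by rewrite addrA addNr sub0r; lra.
have inf_le x v c : K v c -> inf (A x) <= q (x - v) + c.
  by move=> Kvc; apply: ge_inf => //; exists v, c.
exists (fun x => inf (A x)); split.
- split=> [x y|t x t0].
    apply: le_infD => // _ _ [v [c [Kvc ->]]] [w [d [Kwd ->]]].
    apply: le_trans (inf_le _ _ _ (KD _ _ _ _ Kvc Kwd)) _.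
    have := hq.1 (x - v) (y - w); rewrite addrACA -opprD; lra.
  rewrite -ler_pdivrMl//; apply: lb_le_inf => // _ [v [c [Kvc ->]]].
  rewrite ler_pdivrMl//; apply: le_trans (inf_le _ _ _ (KZ _ _ _ t0 Kvc)) _.
  by rewrite -scalerBr sublinearZ// mulrDr.
- by move=> x; have := inf_le x 0 0 K0; rewrite subr0 addr0.
- move=> v c Kvc; have := inf_le v v c Kvc.
  by rewrite subrr sublinear0// add0r.
Qed.

(** Zorn's lemma for the reversed pointwise order: a nonempty chain is bounded by its pointwise
    infimum. *)
Lemma minimal_sublinear q : sublinear q ->
  exists m, [/\ sublinear m, forall x, m x <= q x &
    forall p, sublinear p -> (forall x, p x <= m x) -> p = m].
Proof.
move=> hq; pose S := {m : X -> R | sublinear m /\ forall x, m x <= q x}.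
pose le (s t : S) := `[< forall x, sval t x <= sval s x >].
have [| | | |s maxs] := @Zorn S le.
- by move=> s; apply/asboolP.
- move=> r s t /asboolP rs /asboolP st; apply/asboolP => x.
  exact: le_trans (st x) (rs x).
- move=> [s hs] [t ht] /asboolP st /asboolP ts.
  by apply: eq_exist; apply/funext => x; apply/eqP; rewrite eq_le st ts.
(* The empty chain is bounded by [q] itself; [inf] would give the default value 0 there. *)
- move=> C Ctot; have [[s0 Cs0]|C0] := pselect (C !=set0); last first.
    by exists (exist _ q (conj hq (fun x => lexx (q x)))) => s Cs; case: C0; exists s.
  pose A x : set R := [set sval s x | s in C].
  have A0 x : A x !=set0 by exists (sval s0 x), s0.
  have Alb x : has_lbound (A x).
    exists (- q (- x)) => _ [s _ <-]; have [hs sq] := svalP s.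
    by apply: le_trans (sublinearN _ x hs); rewrite lerN2.
  have inf_le x s : C s -> inf (A x) <= sval s x.
    by move=> Cs; apply: ge_inf => //; exists s.
  have hm : sublinear (fun x => inf (A x)) /\ forall x, inf (A x) <= q x.
    split; last by move=> x; apply: le_trans (inf_le x _ Cs0) _; exact: (svalP s0).2.
    split=> [x y|t x t0].
      apply: le_infD => // _ _ [s Cs <-] [u Cu <-].
      (* Subadditivity is applied to the smaller of [s] and [u]. *)
      have [/asboolP su|/asboolP us] := Ctot _ _ Cs Cu.
        apply: le_trans (inf_le _ _ Cu) _; apply: le_trans ((svalP u).1.1 x y) _.
        by rewrite lerD2r.
      apply: le_trans (inf_le _ _ Cs) _; apply: le_trans ((svalP s).1.1 x y) _.
      by rewrite lerD2l.
    rewrite -ler_pdivrMl//; apply: lb_le_inf => // _ [s Cs <-].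
    rewrite ler_pdivrMl//; apply: le_trans (inf_le _ _ Cs) _.
    exact: (svalP s).1.2.
  by exists (exist _ (fun x => inf (A x)) hm) => s Cs; apply/asboolP => x; exact: inf_le.
- have [hs sq] := svalP s; exists (sval s); split => // p hp ps.
  have hp' : sublinear p /\ forall x, p x <= q x.
    by split=> // x; exact: le_trans (ps x) (sq x).
  by have /= <- // := maxs (exist _ p hp') _; apply/asboolP.
Qed.

(** Reducing [m] along the ray of [- y] with value [- m y] gives a smaller sublinear functional,
    equal to [m] by minimality. Hence [m] is odd, and oddness turns subadditivity into
    additivity. *)
Lemma minimal_sublinear_linear m : sublinear m ->
  (forall p, sublinear p -> (forall x, p x <= m x) -> p = m) ->
  linear (m : X -> R^o).
Proof.
move=> hm minm.
have mN y : m (- y) = - m y.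
  apply/eqP; rewrite eq_le; apply/andP; split; last first.
    by have := sublinearN _ y hm; lra.
  pose K v c := exists2 t, 0 <= t & v = t *: - y /\ c = - (t * m y).
  have hK : convex_cone K.
    split.
    - by exists 0; rewrite // scale0r mul0r oppr0.
    - move=> _ _ _ _ [t t0 [-> ->]] [u u0 [-> ->]]; exists (t + u).
        exact: addr_ge0.
      by rewrite scalerDl mulrDl opprD.
    - move=> t _ _ t0 [u u0 [-> ->]]; exists (t * u).
        by rewrite mulr_ge0// ltW.
      by rewrite scalerA mulrN mulrA.
  have [|r [hr rm rK]] := sublinear_reduction _ _ hm hK.
    move=> _ _ [t t0 [-> ->]]; rewrite scalerN opprK.
    have [->|tn0] := eqVneq t 0; first by rewrite scale0r sublinear0// mul0r subrr.
    by rewrite sublinearZ ?lt_neqAle 1?eq_sym ?tn0// subrr.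
  rewrite -(minm _ hr rm); apply: rK.
  by exists 1; rewrite ?scale1r ?mul1r// (minm _ hr rm).
have mD x y : m (x + y) = m x + m y.
  apply/eqP; rewrite eq_le hm.1/=.
  by have := hm.1 (x + y) (- y); rewrite addrK mN; lra.
move=> a x y; rewrite mD; congr (_ + _).
have [a0|a0|->] := ltgtP a 0.
- by rewrite -[a]opprK scaleNr mN sublinearZ ?oppr_gt0// scaleNr.
- exact: sublinearZ.
- by rewrite !scale0r sublinear0.
Qed.

(* The Mazur-Orlicz form of the Hahn-Banach theorem. *)
Lemma mazur_orlicz q K : sublinear q -> convex_cone K ->
  (forall v c, K v c -> 0 <= q (- v) + c) ->
  exists f : X -> R^o, [/\ linear f, forall x, f x <= q x &
    forall v c, K v c -> f v <= c].
Proof.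
move=> hq hK Kq; have [r [hr rq rK]] := sublinear_reduction _ _ hq hK Kq.
have [m [hm mr minm]] := minimal_sublinear _ hr.
exists m; split=> [||v c Kvc]; first exact: minimal_sublinear_linear.
  by move=> x; exact: le_trans (mr x) (rq x).
exact: le_trans (mr v) (rK _ _ Kvc).
Qed.

End Sublinear.

(** * Norm bounds in the dual space *)

Section DualBounds.
Context {R : realType} {X : normedModType R}.
Implicit Types f : dual X.

Lemma dual_bound f (x : X) : `|f x| <= `|f| * `|x|.
Proof.
have [->|x0] := eqVneq x 0; first by rewrite linear0 !normr0 mulr0.
have := @dual_norm_ub R X f (`|x|^-1 *: x).
rewrite normrZ normfV normr_id mulVf ?normr_eq0// => /(_ (lexx _)).
rewrite linearZ/= normrM normfV normr_id mulrC ler_pdivrMr ?normr_gt0//.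
Qed.

Lemma dualBE f g (x : X) : (f - g) x = f x - g x :> R. Proof. by []. Qed.

Lemma dual0 f : f 0 = 0 :> R. Proof. exact: linear0. Qed.

Lemma dualD f (x y : X) : f (x + y) = f x + f y :> R.
Proof. exact: linearD. Qed.

Lemma dualB f (x y : X) : f (x - y) = f x - f y :> R.
Proof. exact: linearB. Qed.

Lemma dualZ f (t : R) (x : X) : f (t *: x) = t * f x :> R.
Proof. exact: linearZ. Qed.

(** The one-sided bound at [- x] bounds the absolute value at [x], which yields continuity. *)
Lemma dual_of_bounded (f : X -> R^o) (M : R) : linear f -> 0 <= M ->
  (forall x, f x <= M * `|x|) -> exists2 g : dual X, g =1 f & `|g| <= M.
Proof.
move=> lf M0 fle.
pose F := HB.pack_for {linear X -> R^o} f (GRing.isLinear.Build R X R^o *:%R f lf).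
have fM x : `|f x| <= M * `|x|.
  rewrite ler_norml fle andbT lerNl -(linearN F) -[`|x|]normrN; exact: fle.
have cf : continuous f.
  apply: (@bounded_linear_continuous _ _ _ F); apply/linear_boundedP.
  exists M; split; first exact: num_real.
  by move=> r Mr x; apply: le_trans (fM x) _; rewrite ler_wpM2r// ltW.
have fP : f \in dual_pred by rewrite inE.
exists (Dual fP) => //; apply: dual_norm_le => x x1.
by apply: le_trans (fM x) _; rewrite -[leRHS]mulr1 ler_wpM2l.
Qed.

End DualBounds.

(** * Enlargements and the distance to [T x] *)

Section Enlargement.
Context {R : realType} {X : normedModType R}.
Implicit Types (T : X -> set (dual X)) (x v : X) (xs : dual X).

(** Otherwise adding [(x, xs)] to the graph would extend it strictly and monotonically. *)
Lemma maximal_monotone_mem T x xs : maximal_monotone T ->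
  (forall y ys, T y ys -> 0 <= (xs - ys) (x - y)) -> T x xs.
Proof.
move=> [Tmon Tmax] xT; apply: contrapT => nTx; apply: Tmax.
pose S y ys := T y ys \/ (y = x /\ ys = xs).
exists (fun y => [set ys | S y ys]); split.
  move=> y ys z zs Sy Sz.
  have [Ty|[-> ->]] : S y ys := Sy; have [Tz|[-> ->]] : S z zs := Sz.
  - exact: Tmon.
  - by have := xT _ _ Ty; rewrite !dualBE !dualB; lra.
  - exact: xT.
  - by rewrite dualBE subrr.
split; first by move=> yys; left.
by move=> sub; apply/nTx/(sub (x, xs)); right.
Qed.

Lemma gap_leP T x xs (l : R) : 0 <= l ->
  (gap x xs T <= l%:E)%E <-> enlargement l T x xs.
Proof.
move=> l0; rewrite /gap ge_max lee_fin l0 andTb; split=> [gl y ys Ty|xT].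
  (* The supremum in [gap] skips [y = x], where the inequality reads [0 <= 0]. *)
  have [->|yx] := eqVneq y x.
    by rewrite !subrr normr0 mulr0 dualBE !dual0 subrr.
  have xy0 : 0 < `|x - y| by rewrite normr_gt0 subr_eq0 eq_sym.
  have : (((xs - ys) (y - x) / `|x - y|)%:E <= l%:E)%E.
    apply: le_trans gl; apply: ereal_sup_ubound; exists (y, ys) => //.
    by split=> //; exact/eqP.
  by rewrite lee_fin ler_pdivrMr// !dualBE !dualB; lra.
apply: ge_ereal_sup => _ [[y ys] [Ty /eqP yx] <-].
change (((xs - ys) (y - x) / `|x - y|)%:E <= l%:E)%E.
have xy0 : 0 < `|x - y| by rewrite normr_gt0 subr_eq0 eq_sym.
rewrite lee_fin ler_pdivrMr//.
by have := xT y ys Ty; rewrite !dualBE !dualB; lra.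
Qed.

(** For [zs] in [T x], write [xs - ys] as [(zs - ys) - (zs - xs)]: monotonicity handles the first
    term and the norm of [zs - xs] the second. *)
Lemma gap_le_dist T x xs : Defs.monotone T -> (gap x xs T <= dist xs (T x))%E.
Proof.
move=> Tmon; apply: le_ereal_inf_tmp => _ [zs Tz <-].
apply/gap_leP => // y ys Ty.
have := Tmon _ _ _ _ Tz Ty; have := dual_bound (zs - xs) (x - y).
rewrite ler_norml !dualBE !dualB; lra.
Qed.

(* For a monotone T this contains the conic combinations of the constraints
   (y - x, (ys - xs) (y - x)): t is the total weight and a the weighted sum of
   the ys - xs.  Only the existence of t and a is used. *)
Definition constraint_cone T x xs : X -> R -> Prop := fun v c =>
  exists2 t, 0 <= t & exists a : dual X, forall y ys, T y ys ->
    a (y - x) - c <= (ys - xs) (t *: (y - x) - v).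

Lemma constraint_cone_convex T x xs : convex_cone (constraint_cone T x xs).
Proof.
split.
- exists 0 => //; exists 0 => y ys _.
  by rewrite scale0r !subr0 dualBE !dual0 subrr.
- move=> u a v b [t t0 [f fP]] [r r0 [g gP]]; exists (t + r).
    exact: addr_ge0.
  exists (f + g) => y ys Ty; have := fP _ _ Ty; have := gP _ _ Ty.
  rewrite !dualBE dualDE !dualB !dualD !dualZ !dualB; lra.
- move=> t v c t0 [r r0 [f fP]]; exists (t * r); first by rewrite mulr_ge0// ltW.
  exists (t *: f) => y ys Ty; have := fP _ _ Ty; rewrite -(ler_pM2l t0).
  rewrite dualZE !dualBE !dualB !dualZ !dualB; lra.
Qed.

(** With weight 1 and functional [ys - xs], the condition at [(z, zs)] is monotonicity between
    [(y, ys)] and [(z, zs)]. *)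
Lemma constraint_cone_graph T x xs y ys : Defs.monotone T -> T y ys ->
  constraint_cone T x xs (y - x) ((ys - xs) (y - x)).
Proof.
move=> Tmon Ty; exists 1 => //; exists (ys - xs) => z zs Tz.
have := Tmon _ _ _ _ Tz Ty.
rewrite scale1r !dualBE !dualB; lra.
Qed.

Lemma constraint_cone_ge0 T x xs v (c l : R) : 0 <= l ->
  (forall eps : R, 0 < eps -> domain (enlargement eps T) `<=` domain T) ->
  enlargement l T x xs -> constraint_cone T x xs v c ->
  0 <= l * `|v| + c.
Proof.
move=> l0 domT xT [t t0 [a aP]]; rewrite leNgt; apply/negP => vc.
pose d := - (l * `|v| + c); have d0 : 0 < d by rewrite oppr_gt0.
(* [D] is chosen so that [s = d / D] satisfies both [st1] and [sav]. *)
pose D := 1 + d * t + `|a| * `|v|.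
have av0 : 0 <= `|a| * `|v| by rewrite mulr_ge0.
have dt0 : 0 <= d * t by rewrite mulr_ge0// ltW.
have D0 : 0 < D by rewrite /D; lra.
pose s := d / D; have s0 : 0 < s by rewrite divr_gt0.
have st1 : s * t <= 1.
  by rewrite /s mulrAC ler_pdivrMr// mul1r /D; lra.
have sav : s * (`|a| * `|v|) < d.
  by rewrite /s mulrAC ltr_pdivrMr// ltr_pM2l// /D; lra.
(* The lower bound [low] puts p in the domain of an enlargement of T, hence of T;
   at y = p it reads m <= 0. *)
pose p := x + s *: v; pose M := l + s * `|a|.
pose m := s * (d - s * (`|a| * `|v|)).
have m0 : 0 < m by rewrite mulr_gt0// subr_gt0.
have M0 : 0 <= M by rewrite addr_ge0// mulr_ge0// ltW.
have low y ys : T y ys -> m - M * `|y - p| <= (ys - xs) (y - p).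
  move=> Ty.
  have yx : y - x = (y - p) + s *: v by rewrite /p opprD addrA subrK.
  (* The first summand is controlled by the enlargement, with nonnegative weight by [st1], and the
     second by the cone condition. *)
  have -> : (ys - xs) (y - p) = (1 - s * t) * (ys - xs) (y - x) +
      s * (ys - xs) (t *: (y - x) - v) :> R.
    rewrite !dualBE /p !dualB !dualD !dualZ !dualB; ring.
  have h1 : - (l * `|y - x|) <= (ys - xs) (y - x).
    have := xT _ _ Ty.
    rewrite distrC !dualBE !dualB; lra.
  have h2 := aP _ _ Ty.
  have h3 : `|y - x| <= `|y - p| + s * `|v|.
    by rewrite yx (le_trans (ler_normD _ _))// normrZ gtr0_norm.
  have h4 : - (`|a| * `|y - p|) - s * (`|a| * `|v|) <= a (y - x).
    have := dual_bound a (y - p); have := dual_bound a v.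
    rewrite !ler_norml => /andP[+ _] /andP[h _].
    rewrite -(ler_pM2l s0) yx dualD dualZ; lra.
  have h5 : l * `|y - x| <= l * `|y - p| + s * (l * `|v|).
    by rewrite mulrCA -mulrDr ler_wpM2l.
  have h6 : (1 - s * t) * - (l * `|y - x|) <= (1 - s * t) * (ys - xs) (y - x).
    by rewrite ler_wpM2l// subr_ge0.
  have h7 : - (l * `|y - p|) - s * (l * `|v|) <= (1 - s * t) * - (l * `|y - x|).
    have : 0 <= s * t * (l * `|y - x|).
      by apply: mulr_ge0; apply: mulr_ge0 => //; exact: ltW.
    lra.
  have h8 : s * (- (`|a| * `|y - p|) - s * (`|a| * `|v|) - c) <=
      s * (ys - xs) (t *: (y - x) - v).
    by rewrite ler_pM2l//; lra.
  rewrite /m /M /d; lra.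
have [ps Tp] : domain T p.
  (* [M] may vanish, while [domT] needs a positive parameter. *)
  apply: (domT (M + 1)); first lra.
  exists xs => y ys Ty; have := low _ _ Ty; have := normr_ge0 (y - p).
  rewrite (distrC p) !dualBE !dualB; lra.
by have := low _ _ Tp; rewrite subrr normr0 dualBE !dual0; lra.
Qed.

Lemma enlargement_dist_le T x xs (l : R) : maximal_monotone T -> 0 <= l ->
  (forall eps : R, 0 < eps -> domain (enlargement eps T) `<=` domain T) ->
  enlargement l T x xs -> (dist xs (T x) <= l%:E)%E.
Proof.
move=> Tmax l0 domT xT.
have [||f [lf fle fK]] := @mazur_orlicz R X (fun v => l * `|v|) _ _
    (constraint_cone_convex T x xs).
- split=> [u v|t v t0]; first by rewrite -mulrDr ler_wpM2l// ler_normD.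
  by rewrite normrZ gtr0_norm// mulrCA.
- by move=> v c Kvc; rewrite normrN; exact: constraint_cone_ge0 Kvc.
have [g gf gl] := dual_of_bounded f l lf l0 fle.
apply: (@le_trans _ _ `|(xs + g) - xs|%:E).
  apply: ereal_inf_lbound; exists (xs + g) => //.
  (* The constraint on [g] at [y - x] says exactly that [(x, xs + g)] is monotonically related to
     [(y, ys)]. *)
  apply: maximal_monotone_mem => // y ys Ty.
  have := fK _ _ (constraint_cone_graph T x xs y ys Tmax.1 Ty).
  rewrite -gf !dualBE dualDE !dualB; lra.
by rewrite lee_fin addrC addKr.
Qed.

End Enlargement.

(** * Regularity and equality of domains *)

Theorem theorem8 (R : realType) (X : completeNormedModType R)
    (T : X -> set (dual X)) (hT : maximal_monotone T) :
  regular T <->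
  (forall eps : R, 0 < eps -> domain (enlargement eps T) = domain T).
Proof.
split=> [[_ reg] eps eps0|domT].
  rewrite eqEsubset; split=> [x [xs xT]|x [xs Tx]].
    (* Regularity makes the distance to [T x] finite, whereas the distance to the empty set is
       [+oo]. *)
    have := (gap_leP T x xs eps (ltW eps0)).2 xT; rewrite reg => xd.
    apply: contrapT => /set0P/negP/negPn/eqP Tx0.
    by move: xd; rewrite Tx0 /dist image_set0 ereal_inf0 leye_eq.
  exists xs => y ys Ty; apply: le_trans (hT.1 _ _ _ _ Tx Ty).
  by rewrite mulNr oppr_le0 mulr_ge0// ltW.
split=> // x xs; apply/eqP; rewrite eq_le gap_le_dist; last exact: hT.1.
have : (0 <= gap x xs T)%E by rewrite /gap le_max lexx.
(* Only a finite gap [l] needs work; it places [xs] in [enlargement l T x]. *)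
case E : (gap x xs T) => [l| |] //; last by rewrite !leey.
rewrite lee_fin andTb => l0; apply: enlargement_dist_le => //.
  by move=> eps /domT ->.
by apply/gap_leP; rewrite // E.
Qed.
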